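(* Let $p>1$ and $\alpha<0$ be real numbers. Then $$2^{\alpha-p}\,\mathcal{A}^{\mathrm{cont}}_{\alpha,p}\le\mathcal{A}^{\mathrm{disc}}_{\alpha,p}\le\mathcal{A}^{\mathrm{cont}}_{\alpha,p}.$$
   Context: $H^1_0(\mathbb{N})$ denotes the space of finitely supported real sequences $u=(u_n)_{n\ge0}$ with $u_0=0$. $\mathcal{A}^{\mathrm{disc}}_{\alpha,p}$ denotes the sharp (largest) constant such that $$\sum_{n=1}^\infty|u_n-u_{n-1}|^p\,n^\alpha\ge\mathcal{A}^{\mathrm{disc}}_{\alpha,p}\sum_{n=1}^\infty|u_n|^p\,n^{\alpha-p}\qquad\text{for all }u\in H^1_0(\mathbb{N}).$$ $\mathcal{A}^{\mathrm{cont}}_{\alpha,p}$ denotes the sharp (largest) constant such that $\int_0^\infty|\varphi'(x)|^p x^\alpha\,dx\ge\mathcal{A}^{\mathrm{cont}}_{\alpha,p}\int_0^\infty|\varphi(x)|^p x^{\alpha-p}\,dx$ for all $\varphi\in C_0^\infty(0,\infty)$; its value (for $\alpha\ne p-1$) is known to be $\left|\frac{\alpha+1-p}{p}\right|^p$. *)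

(* Defs.v *)
From mathcomp Require Import all_boot all_order all_algebra.
From mathcomp Require Import all_classical all_reals all_analysis.

Set Implicit Arguments.
Unset Strict Implicit.
Unset Printing Implicit Defensive.

Import Order.TTheory GRing.Theory Num.Theory.
Import numFieldNormedType.Exports.

Local Open Scope classical_set_scope.
Local Open Scope ring_scope.

Definition H10 (R : realType) : set (nat -> R) :=
  [set u | u 0%N = 0 /\ exists N : nat, forall n : nat, (N <= n)%N -> u n = 0].

(* C_0^oo(0, +oo); a test function is represented by its extension by 0 to
   the whole line, which is again smooth. *)
Definition test_function (R : realType) : set (R -> R) :=
  [set phi : R -> R |
    [/\ forall (n : nat) (x : R), derivable (phi^`(n))%classic x 1,
        compact (closure [set x | phi x != 0])
      & closure [set x | phi x != 0] `<=` `]0, +oo[ ]].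

Definition disc_hardy (R : realType) (alpha p c : R) : Prop :=
  forall u : nat -> R, @H10 R u ->
    (c%:E * \sum_(1 <= n <oo) (`|u n| `^ p * n%:R `^ (alpha - p))%:E
     <= \sum_(1 <= n <oo) (`|u n - u n.-1| `^ p * n%:R `^ alpha)%:E)%E.

Definition cont_hardy (R : realType) (alpha p c : R) : Prop :=
  forall phi : R -> R, @test_function R phi ->
    (c%:E * \int[lebesgue_measure]_(x in `]0%R, +oo[)
              (`|phi x| `^ p * x `^ (alpha - p))%:E
     <= \int[lebesgue_measure]_(x in `]0%R, +oo[)
          (`|(phi^`())%classic x| `^ p * x `^ alpha)%:E)%E.

(* Both sets of admissible constants contain 0, are closed, and are bounded
   above because some u, resp. phi, is nonzero (and has finite energy): the
   suprema below are therefore maxima, i.e. largest constants. *)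
Definition A_disc (R : realType) (alpha p : R) : R :=
  sup [set c : R | disc_hardy alpha p c].

Definition A_cont (R : realType) (alpha p : R) : R :=
  sup [set c : R | cont_hardy alpha p c].

(* Main.v *)
Require Import Defs.
From mathcomp Require Import all_boot all_order all_algebra.
From mathcomp Require Import all_classical all_reals all_analysis.
From mathcomp Require Import measurable_realfun ring lra zify.

Import Order.TTheory GRing.Theory Num.Theory.
Import numFieldNormedType.Exports.

Local Open Scope ring_scope.

(** Put g = (p - 1 - alpha) / p > 0; we show A_cont = g^p and
2^(alpha - p) g^p <= A_disc <= g^p.

Continuous side.  The tangent inequality for t^p at g |phi| / x gives,
pointwise, |phi'|^p x^alpha - g^p |phi|^p x^(alpha-p)
>= g^(p-1) (|phi|^p x^(alpha+1-p))', whose right-hand side integrates to 0.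
Sharpness follows from smooth truncations to [1, 3M] of x^g, both energies of
which grow like ln M.

Discrete side.  With d_k = k^(g-1), w_n = d_1 + ... + d_n <= (n+1)^g / g and
F_n = n^(-g) = n^alpha d_n^(p-1), one has
2^(alpha-p) g^p n^(alpha-p) w_n^(p-1) <= F_n - F_(n+1), and Jensen's inequality
turns this into the discrete Hardy inequality.  The upper bound comes from
u_n = 1 + g (d_1 + ... + d_n) >= n^g for n <= M, brought linearly to 0 at 2M:
both sums are then governed by the harmonic series. *)

(** * Convexity inequalities for powers *)

(** Young's inequality for b and a^(p-1) with exponents p and p/(p-1). Read as a lower bound on b^p,
    it is the tangent line of t^p at a. *)
Lemma powR_tangent (R : realType) (p a b : R) : 1 < p -> 0 <= a -> 0 <= b ->
  p * a `^ (p - 1) * b <= b `^ p + (p - 1) * a `^ p.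
Proof.
move=> p1 a0 b0; have p0 : 0 < p by lra.
have q0 : 0 < p / (p - 1) by rewrite divr_gt0//; lra.
have -> : b `^ p + (p - 1) * a `^ p
    = p * (b `^ p / p + (a `^ (p - 1)) `^ (p / (p - 1)) / (p / (p - 1))).
  rewrite -powRrM mulrCA mulfV ?mulr1; last by lra.
  by field; apply/andP; split; lra.
rewrite -mulrA ler_pM2l// mulrC conjugate_powR ?powR_ge0//.
by field; apply/andP; split; lra.
Qed.

Lemma powRDp (R : realType) (a r s : R) : 0 < a ->
  a `^ (r + s) = a `^ r * a `^ s.
Proof. by move=> a0; rewrite powRD// (gt_eqF a0) implybT. Qed.

Lemma powRBK (R : realType) (a r s : R) : 0 < a ->
  a `^ (r - s) * a `^ (s - r) = 1.
Proof.
by move=> a0; rewrite -powRDp// (_ : _ + _ = 0) ?powRr0//; ring.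
Qed.

(** The convex tangent inequality with exponent 1/r at the points a^r and b^r, rescaled by r
    a^(r-1). *)
Lemma powR_concave_tangent (R : realType) (r a b : R) :
  0 < r -> r <= 1 -> 0 < a -> 0 <= b ->
  b `^ r <= a `^ r + r * a `^ (r - 1) * (b - a).
Proof.
move=> r0; rewrite le_eqVlt => /predU1P[->|r1] a0 b0.
  by rewrite subrr powRr0 !powRr1 ?(ltW a0)//; lra.
have rV : 1 < r^-1 by rewrite invf_gt1.
have rK : r * r^-1 = 1 by rewrite mulfV// gt_eqF.
have := @powR_tangent _ r^-1 (a `^ r) (b `^ r) rV (powR_ge0 _ _) (powR_ge0 _ _).
rewrite -!powRrM mulrBr mulr1 rK !powRr1 ?(ltW a0)// => H.
have X0 : 0 < a `^ (r - 1) by apply: powR_gt0.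
have E : a `^ (1 - r) * a `^ (r - 1) = 1.
  exact: powRBK.
have Ea : a * a `^ (r - 1) = a `^ r by rewrite mulr_powRB1// ltW.
have {H} := ler_wpM2r (ltW X0) (ler_wpM2l (ltW r0) H).
have -> : r * (r^-1 * a `^ (1 - r) * b `^ r) * a `^ (r - 1) =
  b `^ r * (a `^ (1 - r) * a `^ (r - 1)) by field; rewrite gt_eqF.
rewrite E mulr1 => /le_trans; apply; rewrite le_eqVlt; apply/orP; left; apply/eqP.
rewrite -Ea; field; rewrite gt_eqF//.
Qed.

(** With x = b/a this is 1 + r <= x^(-r) + r x, multiplied by a^(-r). That bound is [powR_tangent]
    with exponent 1 + r at two powers of x whose mixed product is x^0. *)
Lemma powRN_tangent (R : realType) (r a b : R) :
  0 < r -> 0 < a -> 0 < b ->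
  r * a `^ (- r - 1) * (a - b) <= b `^ (- r) - a `^ (- r).
Proof.
move=> r0 a0 b0.
have x0 : 0 < b / a by rewrite divr_gt0.
have := @powR_tangent _ (1 + r) ((b / a) `^ (1 + r)^-1) ((b / a) `^ (- r / (1 +
  r)))
  ltac:(lra) (powR_ge0 _ _) (powR_ge0 _ _).
rewrite -!powRrM -mulrA -powRDp//.
rewrite (_ : (1 + r)^-1 * (1 + r - 1) + - r / (1 + r) = 0); last first.
  by field; lra.
have E1 : - r / (1 + r) * (1 + r) = - r by field; lra.
have E2 : (1 + r)^-1 * (1 + r) = 1 by field; lra.
rewrite E1 E2 powRr0 powRr1 ?(ltW x0)// => /(ler_wpM2l (powR_ge0 a (- r))).
have -> : a `^ (- r) * ((b / a) `^ (- r) + (1 + r - 1) * (b / a)) =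
   (a * (b / a)) `^ (- r) + r * (a `^ (- r) * a^-1) * b.
  by rewrite (@powRM _ a) ?(ltW x0) ?(ltW a0)//; ring.
have -> : a * (b / a) = b by field; rewrite gt_eqF.
rewrite -powR_inv1 ?(ltW a0)// -powRDp//.
have : a * a `^ (- r - 1) = a `^ (- r).
  by rewrite -{1}(powRr1 (ltW a0)) -powRDp//; congr (_ `^ _); ring.
move: (a `^ (- r)) (a `^ (- r - 1)) (b `^ (- r)) => X Y Z <-; lra.
Qed.

(** Since A^p w^(1-p) = w (A/w)^p, this is Jensen's inequality for t^p with weights w and d,
    obtained from tangents at the mean slope [m]. For w = 0 the power 0^(1-p) is 0 by convention, so
    A has to vanish as well. *)
Lemma powR_jensen (R : realType) (p A a w d : R) : 1 < p -> 0 <= A -> 0 <= a ->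
  0 <= w -> 0 < d -> (w = 0 -> A = 0) ->
  (A + a) `^ p * (w + d) `^ (1 - p) <=
  A `^ p * w `^ (1 - p) + a `^ p * d `^ (1 - p).
Proof.
move=> p1 A0 a0 w0 d0 wA.
have scale : forall x y : R, 0 <= x -> 0 <= y -> (y = 0 -> x = 0) ->
    x `^ p * y `^ (1 - p) = y * (x / y) `^ p /\ y * (x / y) = x.
  move=> x y x0; rewrite le_eqVlt => /predU1P[<- /(_ erefl)->|y0 _].
    by rewrite !powR0; lra.
  split; last by field; rewrite gt_eqF.
  rewrite powRM ?invr_ge0 ?(ltW y0)// -powR_inv1 ?(ltW y0)// -powRrM mulN1r
    mulrCA.
  congr (_ * _); rewrite -[X in X * _](powRr1 (ltW y0)) -powRDp//.
have wd0 : 0 < w + d by lra.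
pose m := (A + a) / (w + d).
have m0 : 0 <= m by rewrite divr_ge0//; lra.
have [-> Em] := @scale (A + a) (w + d) ltac:(lra) ltac:(lra) ltac:(lra).
have [-> EA] := scale A w A0 w0 wA.
have [-> Ea] := @scale a d a0 (ltW d0) ltac:(lra).
have H1 := ler_wpM2l w0 (@powR_tangent _ p m (A / w) p1 m0 (divr_ge0 A0 w0)).
have H2 := ler_wpM2l (ltW d0) (@powR_tangent _ p m (a / d) p1 m0 (divr_ge0 a0
  (ltW d0))).
have Ep : m * m `^ (p - 1) = m `^ p by rewrite mulr_powRB1//; lra.
rewrite -/m.
have E1 : w * (p * m `^ (p - 1) * (A / w)) = p * m `^ (p - 1) * A.
  by rewrite -{2}EA; ring.
have E2 : d * (p * m `^ (p - 1) * (a / d)) = p * m `^ (p - 1) * a.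
  by rewrite -{2}Ea; ring.
have E3 : p * m `^ (p - 1) * A + p * m `^ (p - 1) * a = p * m `^ p * (w + d).
  rewrite -mulrDr -Em -/m -Ep; ring.
have -> : (w + d) * m `^ p = p * m `^ p * (w + d) - (p - 1) * m `^ p * (w + d).
  by ring.
rewrite -E3; move: H1 H2; rewrite E1 E2 !mulrDr; lra.
Qed.

(* The term [F n.+1 * ...] is what makes the induction go through: Jensen
   absorbs the new increment, and [F] loses exactly the new potential term. *)
Lemma discrete_hardy_induction (R : realType) (p lam : R)
    (F V d w u : nat -> R) (n : nat) :
  1 < p -> (forall k, 0 < d k.+1) -> w 0 = 0 ->
  (forall k, w k.+1 = w k + d k.+1) -> (forall k, 0 <= F k.+1) ->
  (forall k, lam * V k.+1 * w k.+1 `^ (p - 1) <= F k.+1 - F k.+2) ->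
  u 0 = 0 ->
  lam * (\sum_(1 <= k < n.+1) `|u k| `^ p * V k)
    + F n.+1 * (`|u n| `^ p * w n `^ (1 - p))
  <= \sum_(1 <= k < n.+1) `|u k - u k.-1| `^ p * (F k * d k `^ (1 - p)).
Proof.
move=> p1 d0 w00 wS F0 FV u0; elim: n => [|n IH].
  by rewrite !big_geq// u0 normr0 powR0; lra.
have wn0 k : 0 <= w k.
  by elim: k => [|k]; rewrite ?w00// wS => ?; rewrite addr_ge0// ltW.
have wSn0 k : 0 < w k.+1 by rewrite wS ltr_wpDl.
rewrite !(@big_nat_recr _ _ _ n.+1)//= mulrDr.
apply: le_trans; last by apply: lerD IH (lexx _).
rewrite -!addrA lerD2l.
set a : R := `|u n.+1 - u n|.
have a0 : 0 <= a by exact: normr_ge0.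
have J := @powR_jensen _ p `|u n| a (w n) (d n.+1) p1 (normr_ge0 _) (normr_ge0 _)
   (wn0 n) (d0 n).
have {J} : `|u n.+1| `^ p * w n.+1 `^ (1 - p) <=
    `|u n| `^ p * w n `^ (1 - p) + a `^ p * d n.+1 `^ (1 - p).
  rewrite wS; apply: le_trans; last apply: J.
    rewrite ler_wpM2r ?powR_ge0// ge0_ler_powR ?nnegrE ?addr_ge0//; first lra.
    by have := ler_normD (u n) (u n.+1 - u n); rewrite [u n + _]addrC subrK.
  (* [w n] vanishes only for n = 0, where u_0 = 0. *)
  by case: n {IH a a0} => [|n]; rewrite ?u0 ?normr0// => /eqP; rewrite gt_eqF.
move=> /(ler_wpM2l (F0 n)).
(* The hypothesis on [F], multiplied by |u_(n+1)|^p w_(n+1)^(1-p); the powers of w cancel on the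
   left. *)
have : lam * (`|u n.+1| `^ p * V n.+1) <=
   (F n.+1 - F n.+2) * (`|u n.+1| `^ p * w n.+1 `^ (1 - p)).
  have -> : lam * (`|u n.+1| `^ p * V n.+1) =
     (lam * V n.+1 * w n.+1 `^ (p - 1)) * (`|u n.+1| `^ p * w n.+1 `^ (1 - p)).
    have E : w n.+1 `^ (p - 1) * w n.+1 `^ (1 - p) = 1.
      exact: powRBK.
    by rewrite -[LHS]mulr1 -[X in _ * X = _]E; ring.
  by rewrite ler_wpM2r// mulr_ge0// powR_ge0.
rewrite mulrBl mulrDr [a `^ p * (_ * _)]mulrCA; lra.
Qed.

(** * The discrete inequality *)

(** For g <= 1, concavity gives g k^(g-1) <= k^g - (k-1)^g; for g > 1, convexity gives g k^(g-1) <=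
    (k+1)^g - k^g. Both telescope, and (n+1)^g covers the two cases. *)
Lemma sum_powR_le (R : realType) (g : R) (n : nat) : 0 < g ->
  g * (\sum_(1 <= k < n.+1) k%:R `^ (g - 1)) <= n.+1%:R `^ g.
Proof.
move=> g0; have [g1|g1] := leP g 1.
  apply: (@le_trans _ _ (n%:R `^ g)); last first.
    by rewrite ge0_ler_powR ?nnegrE ?ler0n ?ler_nat// ltW.
  elim: n => [|n IH]; first by rewrite big_geq// mulr0 powR_ge0.
  rewrite big_nat_recr//= mulrDr.
  have := @powR_concave_tangent _ g n.+1%:R n%:R g0 g1 ltac:(by []) ltac:(by []).
  by rewrite -natr1; move: IH; lra.
elim: n => [|n IH]; first by rewrite big_geq// mulr0 powR_ge0.
rewrite big_nat_recr//= mulrDr.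
have := @powR_tangent _ g n.+1%:R n.+2%:R g1 ltac:(by []) ltac:(by []).
have := @mulr_powRB1 _ n.+1%:R g ltac:(by []) g0.
by rewrite -[n.+2%:R]natr1; move: IH => /[swap] <-; lra.
Qed.

(** The tangent of t^(-g) at k+2 bounds the right side below by g (k+2)^(-g-1), while [sum_powR_le]
    bounds the sum by (k+2)^g / g. The exponents match because alpha - p + g (p-1) = -g - 1. *)
Lemma hardy_supersolution (R : realType) (p alpha g : R) (k : nat) :
  1 < p -> 0 < g -> p * g = p - 1 - alpha ->
  2 `^ (alpha - p) * g `^ p * k.+1%:R `^ (alpha - p) *
    (\sum_(1 <= i < k.+2) i%:R `^ (g - 1)) `^ (p - 1)
  <= k.+1%:R `^ (- g) - k.+2%:R `^ (- g).
Proof.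
move=> p1 g0 pg; have k1 : 0 < k.+1%:R :> R by [].
have k2 : 0 < k.+2%:R :> R by [].
apply: le_trans (@powRN_tangent _ g _ _ g0 k2 k1).
rewrite (_ : k.+2%:R - k.+1%:R = 1 :> R) ?mulr1; last first.
  by rewrite -[k.+2%:R]natr1; ring.
set w := \sum_(_ <= _ < _) _.
have w0 : 0 <= w by apply: sumr_ge0 => i _; exact: powR_ge0.
have p10 : 0 <= p - 1 by lra.
have H := @ge0_ler_powR R (p - 1) p10 w (k.+2%:R `^ g / g).
have {H} : w `^ (p - 1) <= k.+2%:R `^ (g * (p - 1)) * (g `^ (p - 1))^-1.
  have gV : g^-1 `^ (p - 1) = (g `^ (p - 1))^-1.
    by rewrite -powR_inv1 ?(ltW g0)// -powRrM mulN1r powRN.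
  rewrite -gV powRrM -powRM ?powR_ge0 ?invr_ge0 ?(ltW g0)//.
  apply: H; rewrite ?nnegrE ?divr_ge0 ?powR_ge0 ?(ltW g0)//.
  by rewrite ler_pdivlMr// mulrC sum_powR_le.
(* From k+2 <= 2(k+1) and alpha - p < 0; this is the source of the factor 2^(alpha-p). *)
have : 2 `^ (alpha - p) * k.+1%:R `^ (alpha - p) <= k.+2%:R `^ (alpha - p).
  rewrite -powRM// -natrM -[alpha - p]opprB !powRN lef_pV2 ?posrE ?powR_gt0//.
  rewrite ge0_ler_powR ?nnegrE//; first by nra.
  by rewrite ler_nat mul2n -addnn addSnnS leq_addl.
move=> H1 H2.
have := ler_wpM2l (powR_ge0 g p) (ler_pM (mulr_ge0 (powR_ge0 _ _) (powR_ge0 _ _))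
  (powR_ge0 _ _) H1 H2).
rewrite [X in _ <= X -> _](_ : _ = g * k.+2%:R `^ (- g - 1)); last first.
  have p0 : 0 < p by lra.
  rewrite -(mulr_powRB1 (ltW g0) p0) (_ : - g - 1 = alpha - p + g * (p - 1)).
    by rewrite (@powRDp _ k.+2%:R _ (g * (p - 1)))//; field; rewrite gt_eqF//
      powR_gt0.
  by nra.
by move/(le_trans _); apply; rewrite le_eqVlt; apply/orP; left; apply/eqP; ring.
Qed.

Lemma discrete_hardy_partial (R : realType) (p alpha g : R) (u : nat -> R) (n :
  nat) :
  1 < p -> 0 < g -> p * g = p - 1 - alpha -> u 0 = 0 ->
  2 `^ (alpha - p) * g `^ p *
    (\sum_(1 <= k < n.+1) `|u k| `^ p * k%:R `^ (alpha - p))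
  <= \sum_(1 <= k < n.+1) `|u k - u k.-1| `^ p * k%:R `^ alpha.
Proof.
move=> p1 g0 pg u0.
pose w k : R := \sum_(1 <= i < k.+1) i%:R `^ (g - 1).
have := @discrete_hardy_induction R p (2 `^ (alpha - p) * g `^ p)
  (fun k => k%:R `^ (- g)) (fun k => k%:R `^ (alpha - p))
  (fun k => k%:R `^ (g - 1)) w u n p1.
move=> /(_ _ _ _ _ _ u0).
(* F_k d_k^(1-p) = k^alpha, because -g + (g-1)(1-p) = alpha; the range excludes k = 0. *)
rewrite [X in _ <= X](_ : _ = \sum_(1 <= k < n.+1) `|u k - u k.-1| `^ p * k%:R
  `^ alpha); last first.
  rewrite [LHS]big_nat_cond [RHS]big_nat_cond; apply: eq_bigr => -[|k]//= _.
  by rewrite -powRrM -powRDp//; congr (_ * _ `^ _); nra.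
move=> H; apply: le_trans (H _ _ _ _ _).
(* The boundary term of the induction is nonnegative and is dropped. *)
- by rewrite lerDl !mulr_ge0 ?powR_ge0.
- by move=> k; rewrite powR_gt0.
- by rewrite /w big_geq.
- by move=> k; rewrite /w big_nat_recr.
- by move=> k; rewrite powR_ge0.
- by move=> k; exact: hardy_supersolution.
Qed.

Lemma disc_hardy_lower (R : realType) (p alpha g : R) :
  1 < p -> 0 < g -> p * g = p - 1 - alpha ->
  disc_hardy alpha p (2 `^ (alpha - p) * g `^ p).
Proof.
move=> p1 g0 pg u [u0 _].
rewrite -nneseriesZl; last by move=> n _; rewrite lee_fin mulr_ge0// powR_ge0.
apply: lee_lim.
- apply: is_cvg_nneseries => n _ _.
  by rewrite mule_ge0// lee_fin !mulr_ge0// powR_ge0.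
- by apply: is_cvg_nneseries => n _ _; rewrite lee_fin !mulr_ge0// powR_ge0.
near=> n.
under eq_bigr do rewrite -EFinM.
rewrite !sumEFin lee_fin -mulr_sumr.
case: (n) => [|m]; first by rewrite !big_geq// mulr0.
exact: discrete_hardy_partial.
Unshelve. all: end_near. Qed.

(** * Sharpness of the discrete inequality *)

Lemma harmonic_sum_unbounded (R : realType) (A : R) :
  exists M : nat, (0 < M)%N /\ A <= \sum_(1 <= k < M.+1) k%:R^-1.
Proof.
apply: contrapT => /forallNP noM; apply: (@dvg_harmonic R).
apply: nondecreasing_is_cvgn.
  by apply: nondecreasing_series => n _ _; exact: harmonic_ge0.
exists (`|A|) => _ [[|n] _ <-].
  by rewrite /series/= big_geq.
rewrite leNgt; apply/negP => An; apply: (noM n.+1); split => //.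
by rewrite big_add1/= (le_trans (ler_norm A))// ltW.
Qed.

(** Both sharpness proofs end here: [h] is the divergent quantity (a harmonic sum or ln M) and [D]
    the bounded cost of truncation. *)
Lemma le_of_asymptotic (R : realType) (c K D : R) :
  (forall A : R, exists h, A <= h /\ c * h <= K * h + D) -> c <= K.
Proof.
move=> H; rewrite leNgt; apply/negP => Kc.
have [h [Ah]] := H ((D + 1) / (c - K)).
by move: Ah; rewrite ler_pdivrMr ?subr_gt0//; lra.
Qed.

(** A substitute for n^g whose increments are exactly g n^(g-1). The leading 1 keeps it above n^g
    when g < 1. *)
Definition power_sum (R : realType) (g : R) (n : nat) : R :=
  1 + g * (\sum_(1 <= k < n.+1) k%:R `^ (g - 1)).

(* [2 * M - n] truncates to [0] beyond [2 * M]. *)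
Definition test_seq (R : realType) (g : R) (M n : nat) : R :=
  if n == 0 then 0 else if (n <= M)%N then power_sum R g n
  else power_sum R g M * (2 * M - n)%N%:R / M%:R.

Lemma power_sumS (R : realType) (g : R) n :
  power_sum R g n.+1 = power_sum R g n + g * n.+1%:R `^ (g - 1).
Proof. by rewrite /power_sum big_nat_recr//= mulrDr addrA. Qed.

(** The tangent inequalities of [sum_powR_le], taken at the other endpoint of each increment. For g
    <= 1 the induction proves the stronger bound by (n+1)^g. *)
Lemma powR_le_power_sum (R : realType) (g : R) n : 0 < g ->
  n%:R `^ g <= power_sum R g n.
Proof.
move=> g0; have [g1|g1] := leP g 1.
  apply: (@le_trans _ _ (n.+1%:R `^ g)).
    by rewrite ge0_ler_powR ?nnegrE ?ler_nat// ltW.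
  elim: n => [|n IH]; first by rewrite powR1 /power_sum big_geq// mulr0 addr0.
  rewrite power_sumS.
  have := @powR_concave_tangent _ g n.+1%:R n.+2%:R g0 g1 ltac:(by []) ltac:(by
    []).
  by rewrite -[n.+2%:R]natr1; move: IH; lra.
elim: n => [|n IH].
  by rewrite powR0 ?gt_eqF// /power_sum big_geq// mulr0 addr0.
rewrite power_sumS.
have := @powR_tangent _ g n.+1%:R n%:R g1 ltac:(by []) ltac:(by []).
have := @mulr_powRB1 _ n.+1%:R g ltac:(by []) g0.
by rewrite -{1}[n.+1%:R]natr1; move: IH => /[swap]; nra.
Qed.

Lemma power_sum_le (R : realType) (g : R) M : 0 < g -> (0 < M)%N ->
  power_sum R g M <= (1 + 2 `^ g) * M%:R `^ g.
Proof.
move=> g0 M0; have M1 : 1 <= M%:R `^ g :> R.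
  by rewrite -{1}(congr1 (@^~ g) (powR1 R)) ge0_ler_powR ?nnegrE ?ler1n// ltW.
rewrite mulrDl mul1r lerD// (le_trans (@sum_powR_le _ _ _ g0))// -powRM//.
rewrite -natrM ge0_ler_powR ?nnegrE ?(ltW g0)// ler_nat; lia.
Qed.

(** The potential sum of the test sequence is at least the harmonic sum up to M, while its
    difference energy is at most g^p times that sum plus a constant independent of M. *)
Lemma disc_hardy_upper (R : realType) (p alpha g c : R) :
  1 < p -> alpha < 0 -> 0 < g -> p * g = p - 1 - alpha ->
  disc_hardy alpha p c -> c <= g `^ p.
Proof.
move=> p1 a0 g0 pg hc; have p0 : 0 < p by lra.
have [c0|c0] := leP c 0; first by rewrite (le_trans c0)// powR_ge0.
(* (1+g)^p pays for the jump from u_0 = 0 to u_1 = 1 + g, and (1 + 2^g)^p for the descent from M to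
   2M. *)
apply: (@le_of_asymptotic _ _ _ ((1 + g) `^ p + (1 + 2 `^ g) `^ p)) => A.
have [M [M0 AM]] := @harmonic_sum_unbounded _ A.
exists (\sum_(1 <= k < M.+1) k%:R^-1); split => //.
have M0' : 0 < M%:R :> R by rewrite ltr0n.
set v := power_sum R g; set u := test_seq R g M.
have v0 n : 0 <= v n by rewrite (le_trans _ (@powR_le_power_sum _ _ _ g0))//
  powR_ge0.
have uN n : (2 * M <= n)%N -> u n = 0.
  move=> Mn; rewrite /u /test_seq ifF; last by lia.
  rewrite ifF; last by lia.
  by rewrite (_ : 2 * M - n = 0)%N ?mulr0 ?mul0r//; lia.
have uM n : (0 < n <= M)%N -> u n = v n.
  by case: n => // n /andP[_ nM]; rewrite /u /test_seq/= nM.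
(* The two formulas agree at n = M, so the increment from M to M+1 already has the slope of the
   descent. *)
have uL n : (M <= n <= 2 * M)%N -> u n = v M * (2 * M - n)%N%:R / M%:R.
  move=> /andP[Mn n2M]; rewrite /u /test_seq ifF; last by lia.
  case: ifP => // nM; have -> : n = M by lia.
  by rewrite (_ : 2 * M - M = M)%N ?mulfK ?gt_eqF//; lia.
have /hc {hc}: @H10 R u by split => //; exists (2 * M)%N.
set L := (X in (_ * X)%E); set U := (X in (_ <= X)%E) => LU.
have /(lee_wpmul2l (ltW c0 : (0 <= c%:E)%E)) L1 :
    ((\sum_(1 <= k < M.+1) k%:R^-1)%:E <= L)%E.
  apply: (@le_trans _ _ (\sum_(1 <= k < M.+1)
      (`|u k| `^ p * k%:R `^ (alpha - p))%:E)%E); last first.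
    by apply: nneseries_lim_ge => n _ _; rewrite lee_fin mulr_ge0// powR_ge0.
  rewrite sumEFin lee_fin ler_sum_nat// => k /andP[k0 kM].
  have k0' : 0 < k%:R :> R by rewrite ltr0n.
  rewrite uM ?k0//.
  rewrite -(powR_inv1 (ltW k0')) (_ : -1 = g * p + (alpha - p)); last by lra.
  rewrite (@powRDp _ _ (g * p))// ler_wpM2r ?powR_ge0// powRrM ge0_ler_powR
    ?nnegrE ?powR_ge0 ?(ltW p0)//.
  by rewrite ger0_norm//; exact: powR_le_power_sum.
have U1 : (U <= (g `^ p * (\sum_(1 <= k < M.+1) k%:R^-1) +
   ((1 + g) `^ p + (1 + 2 `^ g) `^ p))%:E)%E.
  apply: lime_le.
    by apply: is_cvg_nneseries => n _ _; rewrite lee_fin mulr_ge0// powR_ge0.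
  near=> N.
  have NM : (2 * M < N)%N by near: N; exact: nbhs_infty_gt.
  rewrite sumEFin lee_fin.
  rewrite (@big_cat_nat _ _ _ (2 * M).+1)//=.
  rewrite [X in _ + X]big_nat_cond [X in _ + X]big1 ?addr0; last first.
    move=> k; rewrite andbT => /andP[Mk _].
    by rewrite !uN ?subr0 ?normr0 ?powR0 ?mul0r ?gt_eqF//; lia.
  rewrite (@big_cat_nat _ _ _ M.+1)//=; last by lia.
  rewrite addrA; apply: lerD.
    (* The term k = 1 is split off on both sides: on the left it is (1+g)^p, on the right its
       nonnegative g^p is discarded. Each later term equals g^p / k. *)
    rewrite big_nat_recl//= [X in _ <= g `^ p * X + _]big_nat_recl//=.
    rewrite powR1 mulr1 invr1 mulrDr mulr1.
    have -> : u 1 - u 0 = 1 + g.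
      rewrite uM// /v /power_sum big_nat1 powR1 mulr1 /u /test_seq/=; ring.
    rewrite mulr_sumr ger0_norm; last by lra.
    rewrite [leRHS]addrC lerD2l -[leLHS]add0r lerD ?powR_ge0//.
    rewrite [X in X <= _]big_nat_cond [X in _ <= X]big_nat_cond ler_sum//.
    move=> k; rewrite andbT => /andP[k1 kM].
    rewrite !uM//=; try lia.
    rewrite /v power_sumS addrAC subrr add0r.
    rewrite ger0_norm ?mulr_ge0 ?powR_ge0 ?(ltW g0)//.
    rewrite powRM ?powR_ge0 ?(ltW g0)// -mulrA -powRrM -powRDp//.
    by rewrite (_ : _ + alpha = -1) ?powR_inv1//; lra.
  (* On the descent every increment has size v_M / M, and k^alpha <= M^alpha because alpha < 0. *)
  apply: (@le_trans _ _ (\sum_(M.+1 <= k < (2 * M).+1)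
      (v M / M%:R) `^ p * M%:R `^ alpha)).
    apply: ler_sum_nat => k /andP[Mk k2M].
    have k0' : 0 < k%:R :> R by rewrite ltr0n; lia.
    apply: ler_pM; rewrite ?powR_ge0//.
      rewrite !uL; try lia.
      rewrite (_ : 2 * M - k.-1 = (2 * M - k).+1)%N; last by lia.
      rewrite -natr1 (_ : _ - _ = - (v M / M%:R)); last by field; rewrite gt_eqF.
      by rewrite normrN ger0_norm// divr_ge0// ltW.
    rewrite -[alpha]opprK !(powRN _ (- alpha)) lef_pV2 ?posrE ?powR_gt0//.
    by rewrite ge0_ler_powR ?nnegrE ?ler_nat; try lia; lra.
  rewrite sumr_const_nat (_ : (2 * M).+1 - M.+1 = M)%N; last by lia.
  rewrite -[leLHS]mulr_natr.
  apply: (@le_trans _ _ (((1 + 2 `^ g) * M%:R `^ g / M%:R) `^ p * M%:R `^ alpha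
    * M%:R)).
    rewrite ler_wpM2r ?(ltW M0')// ler_wpM2r ?powR_ge0//.
    have vM : v M / M%:R <= (1 + 2 `^ g) * M%:R `^ g / M%:R.
      by rewrite ler_wpM2r ?invr_ge0 ?(ltW M0')// power_sum_le.
    have vM0 : 0 <= v M / M%:R by rewrite divr_ge0// ltW.
    by rewrite ge0_ler_powR ?nnegrE ?(ltW p0)// (le_trans vM0).
  rewrite -[_ * _ / _]mulrA (_ : M%:R `^ g / M%:R = M%:R `^ (g - 1)); last first.
    by rewrite powRDp// powR_inv1// ltW.
  rewrite powRM ?powR_ge0 ?addr_ge0 ?powR_ge0// -powRrM -!mulrA.
  (* The M terms contribute one more power of M, and (g-1)p + alpha + 1 = 0 makes the total
     independent of M. *)
  rewrite -[X in _ * (_ * (_ * X))](powRr1 (ltW M0')) -!powRDp//.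
  by rewrite (_ : (g - 1) * p + (alpha + 1) = 0) ?powRr0 ?mulr1//; lra.
by have := le_trans L1 (le_trans LU U1); rewrite -EFinM lee_fin.
Unshelve. all: end_near. Qed.

(** * The continuous inequality *)

Local Open Scope classical_set_scope.

Lemma derivable_continuous (R : realType) (f : R -> R) (x : R) :
  derivable f x 1 -> {for x, continuous f}.
Proof. by move=> /derivable1_diffP/differentiable_continuous. Qed.

Lemma is_derive_continuous (R : realType) (f : R -> R) (x df : R) :
  is_derive x 1 f df -> {for x, continuous f}.
Proof. by move=> [? _]; exact: derivable_continuous. Qed.

(** For q = p - 1 this is |t|^(p-2) t, the derivative of |t|^p up to the factor p, in a form that is
    continuous at 0 even when p < 2. *)
Definition signed_powR (R : realType) (q t : R) : R := Num.sg t * `|t| `^ q.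

(** Right of 0 it is a differentiable power, left of 0 oddness applies, and at 0 the radius e^(1/q)
    works for e. *)
Lemma continuous_signed_powR (R : realType) (q : R) :
  0 < q -> continuous (signed_powR R q).
Proof.
move=> q0 /= t; have pos (s : R) : 0 < s -> {for s, continuous (signed_powR R q)}.
  move=> s0; have /is_derive_continuous : is_derive s 1 (@powR R ^~ q) (q * s
    `^ (q - 1)).
    exact: is_derive1_powR.
  rewrite /prop_for /continuous_at.
  rewrite [X in _ --> X -> _](_ : _ = signed_powR R q s); last first.
    by rewrite /signed_powR gtr0_sg// mul1r gtr0_norm.
  apply: cvg_trans; apply: near_eq_cvg; near=> z.
  have z0 : 0 < z by near: z; exact: lt_nbhsr.
  by rewrite /signed_powR gtr0_sg// mul1r gtr0_norm.
have [t0|t0|->] := ltgtP t 0; last 2 first.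
- exact: pos.
- apply/cvgrPdist_lt => e e0; near=> z.
  rewrite {1}/signed_powR sgr0 mul0r sub0r normrN /signed_powR normrM.
  have [->|z0] := eqVneq z 0; first by rewrite sgr0 normr0 mul0r.
  rewrite normr_sg z0 mul1r ger0_norm ?powR_ge0//.
  have -> : e = (e `^ q^-1) `^ q by rewrite -powRrM mulVf ?gt_eqF// powRr1// ltW.
  rewrite gt0_ltr_powR ?nnegrE ?powR_ge0//.
  near: z; exists (e `^ q^-1); first exact: powR_gt0.
  by move=> y /=; rewrite sub0r normrN.
rewrite (_ : signed_powR R q = fun z => - signed_powR R q (- z)); last first.
  by apply/funext => z; rewrite /signed_powR sgrN normrN mulNr opprK.
rewrite /continuous_at; apply: cvgN.
have := pos (- t); rewrite oppr_gt0 => /(_ t0) H.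
apply: (@continuous_comp _ _ _ (-%R : R -> R) (signed_powR R q) t) => //.
exact: opp_continuous.
Unshelve. all: end_near. Qed.

Lemma is_derive_norm_powR (R : realType) (p t : R) : 1 < p ->
  is_derive t 1 (fun s : R => `|s| `^ p) (p * signed_powR R (p - 1) t).
Proof.
move=> p1; have pos (s : R) : 0 < s ->
    is_derive s 1 (fun s : R => `|s| `^ p) (p * signed_powR R (p - 1) s).
  move=> s0; rewrite /signed_powR gtr0_sg// mul1r gtr0_norm//.
  apply: (@near_eq_is_derive _ _ _ (@powR R ^~ p)).
    near=> z; have z0 : 0 < z by near: z; exact: lt_nbhsr.
    by rewrite gtr0_norm.
  exact: is_derive1_powR.
have [t0|t0|->] := ltgtP t 0; last 2 first.
- exact: pos.
(* At 0, |z|^p is z times a continuous function vanishing at 0, so the derivative exists there and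
   is 0. *)
- apply/is_derive1_caratheodory; exists (signed_powR R (p - 1)); split.
  + move=> z; rewrite normr0 powR0 ?subr0; last by lra.
    rewrite /signed_powR mulrAC -normrEsg mulr_powRB1//; lra.
  + by apply: continuous_signed_powR; lra.
  + by rewrite /signed_powR sgr0 mul0r mulr0.
have Nt0 : 0 < - t by rewrite oppr_gt0.
have := @is_derive1_comp _ _ -%R t _ _ (pos (- t) Nt0) (is_deriveNid _ _).
rewrite (_ : _ \o _ = (fun s : R => `|s| `^ p)); last first.
  by apply/funext => s /=; rewrite normrN.
by rewrite /signed_powR sgrN normrN mulNr mulrN1 mulrN opprK.
Unshelve. all: end_near. Qed.

(** The compact support is bounded and, as 0 lies in its open complement, stays at a positive
    distance [e] from 0. The integrals thus reduce to a segment on which all powers of x are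
    continuous. *)
Lemma test_function_support (R : realType) (phi : R -> R) :
  @test_function R phi ->
  exists a b : R, [/\ 0 < a, a < b & forall x : R, (x <= a) || (b <= x) -> phi
    x = 0].
Proof.
move=> [_ cpt sub]; set K := closure _ in cpt sub.
have [M [_ /(_ (`|M| + 1)) HM]] := compact_bounded cpt.
have M1 : M < `|M| + 1 by have := ler_norm M; lra.
have {HM}bnd (x : R) : K x -> x < `|M| + 2.
  move=> Kx; have : `|x| <= `|M| + 1 by exact: HM M1 x Kx.
  have := ler_norm x; lra.
have [e /= e0 He] : \forall x \near 0, (~` K) x.
  apply: open_nbhs_nbhs; split; first by rewrite openC; exact: closed_closure.
  by move=> /sub; rewrite /= in_itv/= ltxx.
have low x : K x -> e <= x.
  move=> Kx; rewrite leNgt; apply/negP => xe; apply: (He x) => //=.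
  have := sub _ Kx; rewrite /= in_itv/= andbT => x0.
  by rewrite sub0r normrN gtr0_norm.
exists (e / 2), (`|M| + e + 2); split; first by rewrite divr_gt0.
  have := normr_ge0 M; move: e0; lra.
move=> x; apply: contraTeq => phix.
have Kx : K x by exact: subset_closure.
by have := low x Kx; have := bnd x Kx; move: (e0); lra.
Qed.

Lemma eq_integral_support (R : realType) (D E : set R) (f : R -> \bar R) :
  E `<=` D -> (forall x, D x -> ~ E x -> f x = 0%E) ->
  (\int[lebesgue_measure]_(x in D) f x = \int[lebesgue_measure]_(x in E) f x)%E.
Proof.
move=> ED f0; rewrite integral_mkcond [RHS]integral_mkcond; congr (integral _ _
  _).
apply/funext => x; rewrite /patch; case: ifPn => [/set_mem Dx|/negP Dx].
  by case: ifPn => // /negP Ex; apply: f0 => // /mem_set.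
by case: ifPn => // /set_mem/ED/mem_set.
Qed.

(* Tangent inequality at [g |phi| / x]; the extra terms on the left are the
   derivative of [|phi| ^ p x ^ (alpha + 1 - p)]. *)
Lemma hardy_pointwise (R : realType) (p alpha g x y z : R) :
  1 < p -> 0 < g -> p * g = p - 1 - alpha -> 0 < x ->
  g `^ p * (`|y| `^ p * x `^ (alpha - p)) + g `^ (p - 1) *
    (p * signed_powR R (p - 1) y * z * x `^ (alpha + 1 - p)
     + `|y| `^ p * ((alpha + 1 - p) * x `^ (alpha - p)))
  <= `|z| `^ p * x `^ alpha.
Proof.
move=> p1 g0 pg x0; have p0 : 0 < p by lra.
have a0 : 0 <= g * `|y| / x by rewrite !mulr_ge0 ?invr_ge0 ?(ltW g0) ?(ltW x0).
have := ler_wpM2r (powR_ge0 x alpha) (@powR_tangent _ p _ `|z| p1 a0 (normr_ge0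
  z)).
have split_pow r : (g * `|y| / x) `^ r = g `^ r * `|y| `^ r * x `^ (- r).
  rewrite !powRM ?mulr_ge0 ?invr_ge0 ?(ltW g0) ?(ltW x0)//.
  by rewrite -(powR_inv1 (ltW x0)) -powRrM mulN1r.
rewrite !split_pow.
have e1 : x `^ (- (p - 1)) * x `^ alpha = x `^ (alpha + 1 - p).
  by rewrite -powRDp//; congr (_ `^ _); ring.
have e2 : x `^ (- p) * x `^ alpha = x `^ (alpha - p).
  by rewrite -powRDp//; congr (_ `^ _); ring.
have eg : g `^ p = g * g `^ (p - 1) by rewrite mulr_powRB1// ltW.
(* The exact derivative carries the signed product, the tangent inequality the absolute one. *)
have szle : signed_powR R (p - 1) y * z <= `|y| `^ (p - 1) * `|z|.
  apply: (le_trans (ler_norm _)); rewrite normrM ler_wpM2r// /signed_powR normrM.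
  by rewrite normr_sg (ger0_norm (powR_ge0 _ _)) ler_piMl ?powR_ge0//; case: (_
    != _).
have C0 : 0 <= p * g `^ (p - 1) * x `^ (alpha + 1 - p).
  by rewrite !mulr_ge0 ?powR_ge0// ltW.
have := ler_wpM2l C0 szle.
rewrite mulrDl -[X in _ <= _ + X -> _]mulrA.
rewrite (_ : p * (_ * _ * _) * _ * _ = p * g `^ (p - 1) * (`|y| `^ (p - 1) *
  `|z|) *
   (x `^ (- (p - 1)) * x `^ alpha)); last by ring.
rewrite (_ : (p - 1) * (_ * x `^ alpha) = (p - 1) * (g `^ p * `|y| `^ p) * (x
  `^ (- p) * x `^ alpha)); last by ring.
(* With alpha + 1 - p = -p g, the terms in |y|^p x^(alpha-p) add up to -(p-1) g^p, as in the tangent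
   inequality. *)
rewrite e1 e2 eg (_ : alpha + 1 - p = - (p * g)); last by lra.
nra.
Qed.

Lemma derive1_eq0_off (R : realType) (phi : R -> R) (a b : R) :
  (forall x, (x <= a) || (b <= x) -> phi x = 0) ->
  forall x, (x < a) || (b < x) -> (phi^`())%classic x = 0.
Proof.
move=> phi0 x xab; rewrite derive1E.
rewrite (@near_eq_derive _ _ _ _ (cst 0)) ?derive_cst//.
move: xab => /orP[xa|bx]; near=> z; apply: phi0.
- by apply/orP; left; apply/ltW; near: z; exact: lt_nbhsl.
- by apply/orP; right; apply/ltW; near: z; exact: lt_nbhsr.
Unshelve. all: end_near. Qed.

Lemma continuous_itv_integrable (R : realType) (a b : R) (f : R -> R) :
  (forall x, x \in `[a, b]%R -> {for x, continuous f}) ->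
  lebesgue_measure.-integrable `[a, b] (EFin \o f).
Proof.
move=> cf; have cfw : {within `[a, b], continuous f}.
  by apply: continuous_in_subspaceT => x /set_mem xab; exact: (cf x xab).
by apply: continuous_compact_integrable => //; exact: segment_compact.
Qed.

Lemma cont_hardy_lower (R : realType) (p alpha g : R) :
  1 < p -> 0 < g -> p * g = p - 1 - alpha -> cont_hardy alpha p (g `^ p).
Proof.
move=> p1 g0 pg phi phiT; have p0 : 0 < p by lra.
have [a [b [a0 ab phi0]]] := test_function_support _ _ phiT.
have dphi (x : R) : derivable phi x 1 by case: phiT => /(_ 0%N).
have ddphi (x : R) : derivable (phi^`())%classic x 1 by case: phiT => /(_ 1%N).
set dphi' : R -> R := (phi^`())%classic.
have dphiE (x : R) : is_derive x 1 phi (dphi' x).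
  by rewrite /dphi' derive1E; exact/derivableP.
have itv0 (x : R) : x \in `[a, b]%R -> 0 < x by rewrite in_itv/= =>
  /andP[/(lt_le_trans a0)].
have off (x : R) : ~ `[a, b]%classic x -> (x < a) || (b < x).
  by move=> /negP; rewrite in_itv/= negb_and -!ltNge.
have sub : (`[a, b]%classic : set R) `<=` `]0, +oo[%classic.
  by move=> x /itv0; rewrite /= in_itv/= andbT.
rewrite !(@eq_integral_support _ `]0, +oo[%classic `[a, b]%classic)//; first last.
- move=> x _ /off xab; rewrite phi0 ?normr0 ?powR0 ?mul0r//; first by lra.
  by case/orP: xab => /ltW ->; rewrite ?orbT.
- move=> x _ /off xab; rewrite /dphi' (derive1_eq0_off _ _ _ _ phi0 _ xab)
  normr0 powR0 ?mul0r//.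
  by lra.
pose A (x : R) : R := `|dphi' x| `^ p * x `^ alpha.
pose B (x : R) : R := `|phi x| `^ p * x `^ (alpha - p).
pose G (x : R) : R := `|phi x| `^ p * x `^ (alpha + 1 - p).
pose G' (x : R) : R := p * signed_powR R (p - 1) (phi x) * dphi' x * x `^
  (alpha + 1 - p)
     + `|phi x| `^ p * ((alpha + 1 - p) * x `^ (alpha - p)).
have cpow (r x : R) : 0 < x -> {for x, continuous (fun x : R => x `^ r)}.
  by move=> x0; apply: is_derive_continuous; exact: is_derive1_powR.
have cphi (x : R) : {for x, continuous phi} by exact: derivable_continuous.
have cdphi (x : R) : {for x, continuous dphi'} by exact: derivable_continuous.
have cnorm (f : R -> R) (x : R) : {for x, continuous f} ->
    {for x, continuous (fun x => `|f x| `^ p)}.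
  move=> cf; apply: (@continuous_comp _ _ _ f (fun y : R => `|y| `^ p)) => //.
  by apply: is_derive_continuous; exact: is_derive_norm_powR.
have cA (x : R) : x \in `[a, b]%R -> {for x, continuous A}.
  by move=> /itv0 x0; apply: continuousM; [exact: cnorm|exact: cpow].
have cB (x : R) : x \in `[a, b]%R -> {for x, continuous B}.
  by move=> /itv0 x0; apply: continuousM; [exact: cnorm|exact: cpow].
have cG' x : x \in `[a, b]%R -> {for x, continuous G'}.
  move=> /itv0 x0; apply: continuousD.
    apply: continuousM; last exact: cpow.
    apply: continuousM; last exact: cdphi.
    apply: continuousM; first exact: cst_continuous.
    apply: (@continuous_comp _ _ _ phi (signed_powR R (p - 1))) => //.
    by apply: continuous_signed_powR; lra.
  apply: continuousM; first exact: cnorm.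
  by apply: continuousM; [exact: cst_continuous|exact: cpow].
have dG (x : R) : x \in `[a, b]%R -> is_derive x 1 G (G' x).
  move=> /itv0 x0.
  have H1 : is_derive x 1 (fun x => `|phi x| `^ p) (p * signed_powR R (p - 1)
    (phi x) * dphi' x).
    exact: (@is_derive1_comp _ (fun y : R => `|y| `^ p) phi x _ _
      (is_derive_norm_powR _ _ _ p1) (dphiE x)).
  have H2 := @is_derive1_powR R (alpha + 1 - p) x x0.
  apply: (is_derive_eq (is_deriveM H1 H2)).
  rewrite /G' /GRing.scale/= (_ : alpha + 1 - p - 1 = alpha - p); last by ring.
  ring.
(* The primitive [G] vanishes at both ends, since [phi] does. *)
have intG' : (\int[lebesgue_measure]_(x in `[a, b]) (G' x)%:E = 0)%E.
  rewrite (@continuous_FTC2 _ _ G)//.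
  - by rewrite /G !phi0 ?lexx ?orbT// !normr0 powR0 ?mul0r ?subee//; lra.
  - by apply: continuous_in_subspaceT => x /set_mem; exact: cG'.
  - split.
    + move=> x xab; have /dG[] // : x \in `[a, b]%R by exact: subset_itv_oo_cc.
    + apply: cvg_at_right_filter; apply: is_derive_continuous; apply: dG.
      by rewrite in_itv/= lexx ltW.
    + apply: cvg_at_left_filter; apply: is_derive_continuous; apply: dG.
      by rewrite in_itv/= lexx ltW.
  - move=> x xab; rewrite derive1E; have /dG[] // : x \in `[a, b]%R by exact:
    subset_itv_oo_cc.
have iA := continuous_itv_integrable _ _ _ _ cA.
have iB := continuous_itv_integrable _ _ _ _ cB.
have iG' := continuous_itv_integrable _ _ _ _ cG'.
have mab : measurable (`[a, b]%classic : set (measurableTypeR R)) by exact: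
  measurable_itv.
(* Adding a multiple of this zero integral allows comparison of integrands by [hardy_pointwise]. *)
have -> : ((g `^ p)%:E * \int[lebesgue_measure]_(x in `[a, b]) (B x)%:E =
  \int[lebesgue_measure]_(x in `[a, b]) ((g `^ p)%:E * (B x)%:E + (g `^ (p -
    1))%:E * (G' x)%:E))%E.
  rewrite integralD//; try exact: integrableZl.
  by rewrite !integralZl// intG' mule0 adde0.
apply: le_integral => //.
- by apply: integrableD => //; exact: integrableZl.
- move=> x /set_mem/itv0 x0; rewrite -!EFinM -EFinD lee_fin.
  exact: hardy_pointwise.
Qed.

(** * A smooth step function *)

(** The recursion takes the innermost derivative first, so closure under operations follows by
    induction on n with the functions generalized, without formulas for iterated derivatives. *)
Fixpoint n_derivable (R : realType) (n : nat) (f : R -> R) : Prop :=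
  if n is m.+1 then (forall x : R, derivable f x 1) /\ n_derivable R m (derive1 f)
  else True.

Definition smooth (R : realType) (f : R -> R) := forall n, n_derivable R n f.

Lemma smooth_derivable (R : realType) (f : R -> R) : smooth R f ->
  forall n (x : R), derivable f^`(n) x 1.
Proof.
move=> sf n; have := sf n.+1; elim: n f {sf} => [|n IH] f.
  by case.
by case=> _ /IH; rewrite derive1Sn.
Qed.

Lemma n_derivable_is_derive (R : realType) n (f df : R -> R) :
  (forall x : R, is_derive x 1 f (df x)) -> n_derivable R n df ->
  n_derivable R n.+1 f.
Proof.
move=> H; have <- : derive1 f = df.
  by apply/funext => x; rewrite derive1E; exact: derive_val.
by split => // x; case: (H x).
Qed.

Lemma n_derivableS (R : realType) n (f : R -> R) :
  n_derivable R n.+1 f -> n_derivable R n f.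
Proof. by elim: n f => //= n IH f [df /IH]. Qed.

Lemma n_derivable1 (R : realType) n (f : R -> R) (x : R) :
  n_derivable R n.+1 f -> is_derive x 1 f (derive1 f x).
Proof. by case=> df _; rewrite derive1E; exact/derivableP. Qed.

Lemma n_derivable_cst (R : realType) n (k : R) : n_derivable R n (fun=> k).
Proof.
by elim: n k => // n IH k; apply: (@n_derivable_is_derive _ _ _ (fun=> 0)).
Qed.

Lemma n_derivableD (R : realType) n (f g : R -> R) :
  n_derivable R n f -> n_derivable R n g ->
  n_derivable R n (fun x => f x + g x).
Proof.
elim: n f g => // n IH f g nf ng.
apply: (@n_derivable_is_derive R _ _ (fun x : R => derive1 f x + derive1 g x))
  => [x|].
  exact: is_deriveD (n_derivable1 _ _ _ _ nf) (n_derivable1 _ _ _ _ ng).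
by apply: IH; [case: nf|case: ng].
Qed.

Lemma n_derivableM (R : realType) n (f g : R -> R) :
  n_derivable R n f -> n_derivable R n g ->
  n_derivable R n (fun x => f x * g x).
Proof.
elim: n f g => // n IH f g nf ng.
apply: (@n_derivable_is_derive R _ _ (fun x : R => f x * derive1 g x + g x *
  derive1 f x)) => [x|].
  exact: is_deriveM (n_derivable1 _ _ _ _ nf) (n_derivable1 _ _ _ _ ng).
by apply: n_derivableD; apply: IH; try exact: n_derivableS; [case: ng|case: nf].
Qed.

Lemma n_derivableZ (R : realType) n (k : R) (f : R -> R) :
  n_derivable R n f -> n_derivable R n (fun x => k * f x).
Proof. by apply: n_derivableM; exact: n_derivable_cst. Qed.

Lemma n_derivable_div (R : realType) n (f g : R -> R) :
  (forall x, g x != 0) -> n_derivable R n f -> n_derivable R n g ->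
  n_derivable R n (fun x => f x / g x).
Proof.
elim: n f g => // n IH f g g0 nf ng.
(* The derivative is again a quotient with nonvanishing denominator; the factor -1 expresses the
   difference through sums and multiples. *)
apply: (@n_derivable_is_derive R _ _
  (fun x : R => (derive1 f x * g x + -1 * (f x * derive1 g x)) / (g x * g x)))
    => [x|].
  have dV := is_deriveV (g0 x) (n_derivable1 _ _ _ x ng).
  have dM := is_deriveM (n_derivable1 _ _ _ x nf) dV.
  apply: (is_derive_eq dM).
  by rewrite /GRing.scale/=; field; exact: g0.
apply: IH => [x||].
- by rewrite mulf_neq0.
- apply: n_derivableD; first by apply: n_derivableM; [case: nf|exact:
  n_derivableS].
  by apply/n_derivableZ/n_derivableM; [exact: n_derivableS|case: ng].
- by apply: n_derivableM; exact: n_derivableS.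
Qed.

Lemma n_derivable_affine (R : realType) n (f : R -> R) (k l : R) :
  n_derivable R n f -> n_derivable R n (fun x => f (k * x + l)).
Proof.
elim: n f => // n IH f nf.
apply: (@n_derivable_is_derive R _ _ (fun x : R => k * derive1 f (k * x + l)))
  => [x|].
  have H : is_derive x 1 (fun x : R => k * x + l) k.
    have := is_deriveD (is_deriveZ k (is_derive_id x 1)) (is_derive_cst l x 1).
    by rewrite addr0 /GRing.scale/= mulr1.
  rewrite mulrC.
  exact: (@is_derive1_comp _ f _ x _ _ (n_derivable1 _ _ _ _ nf) H).
by apply/n_derivableZ/IH; case: nf.
Qed.

(** The functions t^(-k) e^(-1/t), extended by 0. Only k = 0 enters [step]; the others make the
    family closed under differentiation up to linear combinations. *)
Definition flat (R : realType) (k : nat) (t : R) : R :=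
  if 0 < t then t^-1 ^+ k * expR (- t^-1) else 0.

Lemma flat_ge0 (R : realType) k (t : R) : 0 <= flat R k t.
Proof.
rewrite /flat; case: ifPn => // t0.
by rewrite mulr_ge0 ?expR_ge0// exprn_ge0// invr_ge0 ltW.
Qed.

(** From e^(1/t) >= (1/t)^(k+1) / (k+1)!; it yields continuity at 0. *)
Lemma flat_le (R : realType) k (t : R) : 0 < t -> flat R k t <= k.+1`!%:R * t.
Proof.
move=> t0; rewrite /flat t0 expRN.
have tV : 0 < t^-1 by rewrite invr_gt0.
have := @expR_ge1Dxn R t^-1 k (ltW tV).
move=> H; have {}H : t^-1 ^+ k.+1 / k.+1`!%:R <= expR t^-1 by lra.
rewrite ler_pdivrMr ?expR_gt0//.
have F0 : 0 < k.+1`!%:R :> R by rewrite ltr0n fact_gt0.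
have Ft : 0 <= k.+1`!%:R * t by rewrite mulr_ge0 ?(ltW t0).
apply: le_trans (ler_wpM2l Ft H).
rewrite exprS le_eqVlt; apply/orP; left; apply/eqP; field.
by rewrite !gt_eqF.
Qed.

Lemma is_derive_flat (R : realType) k (t : R) :
  is_derive t 1 (flat R k) (- k%:R * flat R k.+1 t + flat R k.+2 t).
Proof.
have [t0|t0|->] := ltgtP t 0.
- rewrite /flat ltNge (ltW t0)/= mulr0 addr0.
  apply: (@near_eq_is_derive _ _ _ (cst 0)).
  near=> z; rewrite ltNge ifF//; apply/negbF; rewrite ltW//.
  by near: z; exact: lt_nbhsl.
- apply: (@near_eq_is_derive _ _ _ (fun t : R => t^-1 ^+ k * expR (- t^-1))).
    near=> z; rewrite /flat ifT//; near: z; exact: lt_nbhsr.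
  have tn0 : t != 0 by rewrite gt_eqF.
  have dV := @is_deriveV _ id t _ _ tn0 (is_derive_id t 1).
  have dE := @is_derive1_comp _ (@expR R) (fun t : R => - t^-1) t _ _
     (is_derive_expR _) (is_deriveN dV).
  have := is_deriveX k dV; rewrite exprfctE => dX.
  apply: (is_derive_eq (is_deriveM dX dE)).
  rewrite /flat t0 /GRing.scale/=; case: k {dX} => [|k]/=.
    by rewrite !expr0 !exprS; field.
  rewrite !exprS; move: (t^-1 ^+ k) (expR _) => X Y; field.
  by [].
- rewrite /flat ltxx mulr0 addr0 -/(flat R k).
  (* The slope from 0 is [flat R k.+1], because t^(-k) = t t^(-k-1). *)
  apply/is_derive1_caratheodory; exists (flat R k.+1); split.
  + move=> z; rewrite /flat ltxx !subr0; case: ifPn => z0; last by rewrite mul0r.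
    by rewrite exprS; field; rewrite gt_eqF.
  + rewrite /prop_for /continuous_at {2}/flat ltxx.
    apply/cvgrPdist_lt => e e0; near=> z; rewrite sub0r normrN ger0_norm
      ?flat_ge0//.
    have [z0|z0] := leP z 0; first by rewrite /flat [0 < z]ltNge z0.
    apply: (le_lt_trans (flat_le _ _ _ z0)).
    have F0 : 0 < k.+2`!%:R :> R by rewrite ltr0n fact_gt0.
    rewrite mulrC -ltr_pdivlMr//; apply: (le_lt_trans (ler_norm z)).
    near: z; exists (e / k.+2`!%:R); first exact: divr_gt0.
    by move=> y /=; rewrite sub0r normrN.
  + by rewrite /flat ltxx.
Unshelve. all: end_near. Qed.

Lemma smooth_flat (R : realType) k : smooth R (flat R k).
Proof.
move=> n; elim: n k => // n IH k.
apply: (n_derivable_is_derive _ _ _ _ (is_derive_flat R k)).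
by apply: n_derivableD => //; exact: n_derivableZ.
Qed.

(** The denominator never vanishes, as t and 1 - t are not both <= 0. The form -1 * t + 1 fits
    [n_derivable_affine]. *)
Definition step (R : realType) (t : R) : R :=
  flat R 0 t / (flat R 0 t + flat R 0 (-1 * t + 1)).

Lemma flat0_gt0 (R : realType) (t : R) : 0 < t -> 0 < flat R 0 t.
Proof. by move=> t0; rewrite /flat t0 mul1r expR_gt0. Qed.

Lemma step_denom_gt0 (R : realType) (t : R) :
  0 < flat R 0 t + flat R 0 (-1 * t + 1).
Proof.
have [t0|t0] := leP t 0.
  by rewrite ltr_wpDl ?flat_ge0//; apply: flat0_gt0; lra.
by rewrite ltr_pwDl ?flat_ge0//; exact: flat0_gt0.
Qed.

Lemma smooth_step (R : realType) : smooth R (step R).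
Proof.
move=> n; apply: n_derivable_div => [x||].
- by rewrite gt_eqF// step_denom_gt0.
- exact: smooth_flat.
- by apply: n_derivableD; [|apply: n_derivable_affine]; exact: smooth_flat.
Qed.

Lemma step_le0 (R : realType) (t : R) : t <= 0 -> step R t = 0.
Proof. by move=> t0; rewrite /step /flat ltNge t0 mul0r. Qed.

Lemma step_ge1 (R : realType) (t : R) : 1 <= t -> step R t = 1.
Proof.
move=> t1; rewrite /step [X in _ / (_ + X)]/flat ifF; last first.
  by apply/negbTE; rewrite -leNgt; lra.
by rewrite addr0 divff// gt_eqF// flat0_gt0//; lra.
Qed.

Lemma step_itv (R : realType) (t : R) : 0 <= step R t <= 1.
Proof.
have d0 := step_denom_gt0 R t.
rewrite /step divr_ge0 ?flat_ge0 ?(ltW d0)//= ler_pdivrMr// mul1r.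
by rewrite lerDl flat_ge0.
Qed.

Lemma derive1_step_off (R : realType) (t : R) :
  (t < 0) || (1 < t) -> derive1 (step R) t = 0.
Proof.
move=> /orP[t0|t1]; rewrite derive1E.
  rewrite (@near_eq_derive _ _ _ _ (cst 0)) ?derive_cst//.
  by near=> z; apply: step_le0; apply/ltW; near: z; exact: lt_nbhsl.
rewrite (@near_eq_derive R R R _ (cst (1 : R))) ?derive_cst//.
by near=> z; apply: step_ge1; apply/ltW; near: z; exact: lt_nbhsr.
Unshelve. all: end_near. Qed.

(** The derivative is continuous on [0, 1] and zero outside. *)
Lemma derive1_step_bounded (R : realType) :
  exists2 C : R, 0 <= C & forall t : R, `|derive1 (step R) t| <= C.
Proof.
have cd : {within `[0, 1], continuous (fun t : R => `|derive1 (step R) t|)}.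
  apply: continuous_subspaceT => t; apply: continuous_comp.
    apply: derivable_continuous.
    exact: (@smooth_derivable _ _ (smooth_step R) 1%N).
  exact: norm_continuous.
have [c _ Hc] := EVT_max ler01 cd.
exists (`|derive1 (step R) c|) => // t.
have [t01|] := boolP (t \in `[0, 1]%R); first exact: Hc.
rewrite in_itv/= negb_and -!ltNge => toff.
by rewrite (derive1_step_off _ _ toff) normr0.
Qed.

(** * Sharpness of the continuous inequality *)

(** x^a need not be differentiable at 0, but left of 1 the product is locally zero. *)
Lemma is_derive_powRM (R : realType) (a : R) (f : R -> R) (x : R) :
  derivable f x 1 -> (forall y, y < 1 -> f y = 0) ->
  is_derive x 1 (fun y : R => y `^ a * f y)
    (a * x `^ (a - 1) * f x + x `^ a * derive1 f x).
Proof.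
move=> df f0; have [x1|x1] := ltP x 1.
  have -> : derive1 f x = 0.
    rewrite derive1E (@near_eq_derive R R R _ (cst (0 : R))) ?derive_cst//.
    by near=> z; apply: f0; near: z; exact: lt_nbhsl.
  rewrite f0// !mulr0 addr0; apply: (@near_eq_is_derive _ _ _ (cst 0)).
  by near=> z; rewrite f0 ?mulr0//; near: z; exact: lt_nbhsl.
have x0 : 0 < x by exact: lt_le_trans x1.
have df' : is_derive x 1 f (derive1 f x) by rewrite derive1E; exact/derivableP.
apply: (is_derive_eq (is_deriveM (is_derive1_powR a x0) df')).
by rewrite /GRing.scale/=; ring.
Unshelve. all: end_near. Qed.

Lemma n_derivable_powRM (R : realType) n (a : R) (f : R -> R) :
  n_derivable R n f -> (forall y, y < 1 -> f y = 0) ->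
  n_derivable R n (fun x => x `^ a * f x).
Proof.
elim: n a f => // n IH a f nf f0.
apply: (@n_derivable_is_derive R _ _
  (fun x : R => a * (x `^ (a - 1) * f x) + x `^ a * derive1 f x)) => [x|].
  by rewrite mulrA; apply: is_derive_powRM => //; case: nf.
apply: n_derivableD.
  by apply: n_derivableZ; apply: IH => //; exact: n_derivableS.
apply: IH => [|y y1]; first by case: nf.
rewrite derive1E (@near_eq_derive R R R _ (cst (0 : R))) ?derive_cst//.
by near=> z; apply: f0; near: z; exact: lt_nbhsl.
Unshelve. all: end_near. Qed.

(** The first factor rises on [1, 2], the second falls on [2M, 3M]. *)
Definition cutoff (R : realType) (M x : R) : R :=
  step R (1 * x + -1) * step R (- M^-1 * x + 3).

Lemma smooth_cutoff (R : realType) (M : R) : smooth R (cutoff R M).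
Proof.
by move=> n; apply: n_derivableM; apply: n_derivable_affine; exact: smooth_step.
Qed.

Lemma cutoff_itv (R : realType) (M x : R) : 0 <= cutoff R M x <= 1.
Proof.
have /andP[a0 a1] := step_itv R (1 * x + -1).
have /andP[b0 b1] := step_itv R (- M^-1 * x + 3).
by rewrite /cutoff mulr_ge0//= mulr_ile1.
Qed.

Lemma cutoff_off (R : realType) (M x : R) : 0 < M ->
  (x <= 1) || (3 * M <= x) -> cutoff R M x = 0.
Proof.
move=> M0 /orP[x1|xM]; rewrite /cutoff; first by rewrite step_le0 ?mul0r//; lra.
rewrite [X in _ * X]step_le0 ?mulr0// mulNr addrC subr_le0.
by rewrite mulrC ler_pdivlMr.
Qed.

Lemma cutoff1 (R : realType) (M x : R) : 0 < M -> 2 <= x <= 2 * M ->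
  cutoff R M x = 1.
Proof.
move=> M0 /andP[x2 xM]; rewrite /cutoff !step_ge1 ?mulr1//; last by lra.
have : x / M <= 2 by rewrite ler_pdivrMr.
by rewrite mulNr mulrC; lra.
Qed.

Lemma derive1_cutoff (R : realType) (M x : R) : derive1 (cutoff R M) x =
  step R (1 * x + -1) * (- M^-1 * derive1 (step R) (- M^-1 * x + 3)) +
  step R (- M^-1 * x + 3) * derive1 (step R) (1 * x + -1).
Proof.
have aff (k l : R) : is_derive x 1 (fun x : R => step R (k * x + l))
    (k * derive1 (step R) (k * x + l)).
  have H : is_derive x 1 (fun x : R => k * x + l) k.
    have := is_deriveD (is_deriveZ k (is_derive_id x 1)) (is_derive_cst l x 1).
    by rewrite addr0 /GRing.scale/= mulr1.
  rewrite mulrC; apply: (@is_derive1_comp _ (step R) _ x _ _ _ H).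
  exact: (n_derivable1 _ _ _ _ (smooth_step R 1)).
rewrite derive1E; have [_ ->] := is_deriveM (aff 1 (-1)) (aff (- M^-1) 3).
by rewrite /GRing.scale/=; ring.
Qed.

(** x^g is the equality case of [hardy_pointwise], and both its energy densities are multiples of
    1/x. *)
Definition hardy_test (R : realType) (g M x : R) : R := x `^ g * cutoff R M x.

Lemma smooth_hardy_test (R : realType) (g M : R) : 0 < M ->
  smooth R (hardy_test R g M).
Proof.
move=> M0 n; apply: n_derivable_powRM; first exact: smooth_cutoff.
by move=> y y1; rewrite cutoff_off// ltW.
Qed.

Lemma derive1_hardy_test (R : realType) (g M x : R) : 0 < M -> 0 < x ->
  derive1 (hardy_test R g M) x =
  x `^ (g - 1) * (g * cutoff R M x + x * derive1 (cutoff R M) x).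
Proof.
move=> M0 x0; rewrite derive1E.
have dc : derivable (cutoff R M) x 1 by exact: (@smooth_derivable _ _
  (smooth_cutoff R M) 0%N).
have f0 y : y < 1 -> cutoff R M y = 0 by move=> y1; rewrite cutoff_off// ltW.
have [_ ->] := is_derive_powRM _ g _ _ dc f0.
have -> : x `^ g = x * x `^ (g - 1).
  by rewrite -{2}(powRr1 (ltW x0)) -powRDp//; congr (_ `^ _); ring.
ring.
Qed.

Lemma hardy_test_test_function (R : realType) (g M : R) : 1 < M ->
  @test_function R (hardy_test R g M).
Proof.
move=> M1; have M0 : 0 < M by lra.
have sub : closure [set x | hardy_test R g M x != 0] `<=` `[1, 3 * M].
  rewrite closureE => x; apply; split; first exact: interval_closed.
  move=> y /=; apply: contraNT; rewrite in_itv/= negb_and -!ltNge => yoff.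
  rewrite /hardy_test cutoff_off ?mulr0//.
  by case/orP: yoff => /ltW ->; rewrite ?orbT.
split.
- by move=> n x; apply: smooth_derivable; exact: smooth_hardy_test.
- apply: (subclosed_compact _ (@segment_compact _ 1 (3 * M)) sub).
  exact: closed_closure.
- move=> x /sub; rewrite /= !in_itv/= andbT => /andP[x1 _].
  exact: lt_le_trans x1.
Qed.

(** This bounds the factor of x^(g-1) in the derivative of [hardy_test]. The point is that [D] does
    not depend on M: on the outer ramp the slope is of order 1/M but x <= 3M. *)
Lemma hardy_test_energy_le (R : realType) (g : R) : 0 < g ->
  exists2 D : R, 0 <= D & forall M x : R, 1 < M -> 0 < x ->
    `|g * cutoff R M x + x * derive1 (cutoff R M) x| <=
      if (x < 1) || (3 * M < x) then 0
      else if (2 < x) && (x < 2 * M) then g else D.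
Proof.
move=> g0; have [C C0 HC] := derive1_step_bounded R.
(* 3C comes from the outer ramp, where x/M <= 3, and 2C from the inner one, where x <= 2. *)
exists (g + 5 * C) => [|M x M1 x0]; first by lra.
have M0 : 0 < M by lra.
case: ifPn => [xoff|].
  have -> : derive1 (cutoff R M) x = 0.
    by apply: (derive1_eq0_off _ _ 1 (3 * M)) => // y; exact: cutoff_off.
  rewrite cutoff_off//; last by case/orP: xoff => /ltW ->; rewrite ?orbT.
  by rewrite !mulr0 addr0 normr0.
rewrite negb_or -!leNgt => /andP[x1 x3M].
case: ifPn => [/andP[x2 x2M]|xn].
  rewrite derive1_cutoff cutoff1//; last by rewrite (ltW x2) (ltW x2M).
  rewrite !derive1_step_off.
  - by rewrite !mulr0 addr0 mulr0 addr0 mulr1 gtr0_norm.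
  - by apply/orP; right; lra.
  - have : x / M < 2 by rewrite ltr_pdivrMr.
    by rewrite mulNr mulrC => ?; apply/orP; right; lra.
have /andP[c0 c1] := cutoff_itv R M x.
apply: (le_trans (ler_normD _ _)); apply: lerD.
  by rewrite normrM !ger0_norm ?(ltW g0)// ler_piMr// ltW.
have /andP[a0 a1] := step_itv R (1 * x + -1).
have /andP[b0 b1] := step_itv R (- M^-1 * x + 3).
rewrite derive1_cutoff mulrDr; apply: (le_trans (ler_normD _ _)).
rewrite (_ : 5 * C = 3 * C + 2 * C); last by ring.
apply: lerD.
  rewrite (_ : x * (_ * _) = (- (x / M)) * (step R (1 * x + -1) * derive1 (step
    R) (- M^-1 * x + 3))); last by ring.
  rewrite normrM normrN; apply: ler_pM => //.
    by rewrite ger0_norm ?divr_ge0 ?(ltW x0) ?(ltW M0)// ler_pdivrMr.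
  rewrite normrM -[leRHS]mul1r; apply: ler_pM => //.
  by rewrite ger0_norm.
have [x2|x2] := leP x 2.
  rewrite normrM; apply: ler_pM => //; first by rewrite gtr0_norm.
  rewrite normrM -[leRHS]mul1r; apply: ler_pM => //.
  by rewrite ger0_norm.
rewrite [derive1 _ (1 * x + -1)]derive1_step_off.
  by rewrite !mulr0 normr0 mulr_ge0.
by apply/orP; right; lra.
Qed.

Lemma measurable_hardy_integrand (R : realType) (D : set R) (f : R -> R) (p a :
  R) :
  continuous f -> measurable D ->
  measurable_fun D (EFin \o (fun x : R => `|f x| `^ p * x `^ a)).
Proof.
move=> cf mD; apply: measurable_funTS; apply/measurable_EFinP.
apply: measurable_funM; last exact: measurable_powR.
apply: (measurableT_comp (measurable_powR p)).
by apply: measurableT_comp => //; exact: continuous_measurable_fun.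
Qed.

Lemma integral_inv (R : realType) (u v : R) : 0 < u -> u < v ->
  (\int[lebesgue_measure]_(x in `[u, v]) (x^-1)%:E = (ln v - ln u)%:E)%E.
Proof.
move=> u0 uv; have pos (x : R) : x \in `[u, v]%R -> 0 < x.
  by rewrite in_itv/= => /andP[/(lt_le_trans u0)].
have dln (x : R) : x \in `[u, v]%R -> is_derive x 1 (@ln R) x^-1.
  by move=> /pos; exact: is_derive1_ln.
rewrite (@continuous_FTC2 _ _ (@ln R))//.
- apply: continuous_in_subspaceT => x /set_mem/pos x0.
  by apply: cvgV; [rewrite gt_eqF|exact: cvg_id].
- split.
  + by move=> x xuv; have /dln[] // : x \in `[u, v]%R by exact: subset_itv_oo_cc.
  + apply: cvg_at_right_filter; apply: is_derive_continuous; apply: dln.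
    by rewrite in_itv/= lexx ltW.
  + apply: cvg_at_left_filter; apply: is_derive_continuous; apply: dln.
    by rewrite in_itv/= lexx ltW.
- move=> x xuv; rewrite derive1E; have /dln[] // : x \in `[u, v]%R.
  exact: subset_itv_oo_cc.
Qed.

(** [E] is only a subset of the segment so that the open middle range of the test function is
    covered too. *)
Lemma integral_le_ln (R : realType) (u v k : R) (E : set R) (f : R -> \bar R) :
  0 < u -> u < v -> 0 <= k -> measurable E -> E `<=` `[u, v] ->
  measurable_fun E f -> (forall x, E x -> (0 <= f x)%E) ->
  (forall x, E x -> (f x <= (k / x)%:E)%E) ->
  (\int[lebesgue_measure]_(x in E) f x <= (k * (ln v - ln u))%:E)%E.
Proof.
move=> u0 uv k0 mE Euv mf f0 fk.
have pos (x : R) : `[u, v] x -> 0 < x.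
  by rewrite /= in_itv/= => /andP[/(lt_le_trans u0)].
have mV : measurable_fun (`[u, v] : set R) (EFin \o (@GRing.inv R)).
  apply/measurable_EFinP; apply: subspace_continuous_measurable_fun => //.
  apply: continuous_in_subspaceT => x /set_mem/pos x0.
  by apply: cvgV; [rewrite gt_eqF|exact: cvg_id].
have V0 (x : R) : `[u, v] x -> (0 <= (x^-1)%:E)%E.
  by move=> /pos x0; rewrite lee_fin invr_ge0 ltW.
apply: (@le_trans _ _ (\int[lebesgue_measure]_(x in E) (k%:E * (x^-1)%:E))%E).
  apply: ge0_le_integral => //.
  by apply: measurable_funeM; exact: measurable_funS mV.
rewrite ge0_integralZl_EFin//; last first.
- exact: measurable_funS mV.
- by move=> x Ex; apply: V0; exact: Euv.
by rewrite EFinM lee_wpmul2l// -integral_inv//; exact: ge0_subset_integral.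
Qed.

Lemma cont_hardy_upper (R : realType) (p alpha g c : R) :
  1 < p -> 0 < g -> p * g = p - 1 - alpha ->
  cont_hardy alpha p c -> c <= g `^ p.
Proof.
move=> p1 g0 pg hc; have p0 : 0 < p by lra.
have [c0|c0] := leP c 0; first by rewrite (le_trans c0)// powR_ge0.
have [D D0 HD] := hardy_test_energy_le R g g0.
(* The ramps [1, 2] and [2M, 3M] have logarithmic lengths ln 2 and ln(3/2), in total ln 3. *)
apply: (@le_of_asymptotic _ _ _ (D `^ p * ln 3)) => A.
pose M : R := expR (`|A| + 1).
have A1 : 0 < `|A| + 1 by rewrite ltr_wpDl.
have M1 : 1 < M by exact: pexpR_gt1.
have M0 : 0 < M by lra.
exists (ln M); split; first by rewrite /M expRK; have := ler_norm A; lra.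
pose phi := hardy_test R g M.
have sphi := smooth_hardy_test R g M M0.
have cphi : continuous phi.
  by move=> x; apply: derivable_continuous; exact: (smooth_derivable _ _ sphi
    0%N).
have cdphi : continuous (derive1 phi).
  by move=> x; apply: derivable_continuous; exact: (smooth_derivable _ _ sphi
    1%N).
have /hc {hc} := hardy_test_test_function R g M M1; rewrite -/phi.
set L : \bar R := (X in (_ * X)%E); set U : \bar R := (X in (_ <= X)%E) => LU.
have pow_g (x : R) : 0 < x -> (x `^ (g - 1)) `^ p * x `^ alpha = x^-1.
  move=> x0; rewrite -powRrM -powRDp// -(powR_inv1 (ltW x0)); congr (_ `^ _); nra.
(* Only the plateau [2, 2M] is kept; there the integrand is 1/x. *)
have L1 : ((ln M)%:E <= L)%E.
  apply: (@le_trans _ _ (\int[lebesgue_measure]_(x in `[2%R, (2 * M)%R])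
      (`|phi x| `^ p * x `^ (alpha - p))%:E)%E); last first.
    apply: ge0_subset_integral => //.
    - exact: measurable_hardy_integrand.
    - by move=> x _; rewrite lee_fin mulr_ge0// powR_ge0.
    - move=> x /=; rewrite !in_itv/= andbT => /andP[x2 _]; lra.
  have -> : (\int[lebesgue_measure]_(x in `[2%R, (2 * M)%R])
      (`|phi x| `^ p * x `^ (alpha - p))%:E =
      \int[lebesgue_measure]_(x in `[2%R, (2 * M)%R]) (x^-1)%:E)%E.
    apply: eq_integral => x /set_mem/=; rewrite in_itv/= => x2M.
    have x0 : 0 < x by lra.
    congr EFin; rewrite /phi /hardy_test cutoff1// mulr1 ger0_norm ?powR_ge0//.
    by rewrite -powRrM -powRDp// -(powR_inv1 (ltW x0)); congr (_ `^ _); nra.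
  rewrite integral_inv//; last by lra.
  by rewrite lnM ?posrE//; rewrite lee_fin; lra.
have AE (x : R) : 0 < x -> `|derive1 phi x| `^ p * x `^ alpha =
    `|g * cutoff R M x + x * derive1 (cutoff R M) x| `^ p / x.
  move=> x0; rewrite derive1_hardy_test// normrM powRM// (ger0_norm (powR_ge0 _
    _)).
  by rewrite mulrAC pow_g// mulrC.
have U1 : (U <= (g `^ p * ln M + D `^ p * ln 3)%:E)%E.
  pose E1 : set R := `[1, 2]; pose E2 : set R := `]2, 2 * M[.
  pose E3 : set R := `[2 * M, 3 * M].
  have mE1 : measurable E1 by exact: measurable_itv.
  have mE2 : measurable E2 by exact: measurable_itv.
  have mE3 : measurable E3 by exact: measurable_itv.
  have mF (E : set R) : measurable E ->
      measurable_fun E (EFin \o (fun x : R => `|derive1 phi x| `^ p * x `^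
        alpha)).
    exact: measurable_hardy_integrand.
  have F0 (x : R) : (0 <= (`|derive1 phi x| `^ p * x `^ alpha)%:E)%E.
    by rewrite lee_fin mulr_ge0// powR_ge0.
  have bound (k x : R) : 0 < x -> 0 <= k -> `|g * cutoff R M x + x * derive1
    (cutoff R M) x| <= k ->
      ((`|derive1 phi x| `^ p * x `^ alpha)%:E <= (k `^ p / x)%:E)%E.
    move=> x0 k0 kb; rewrite lee_fin AE// ler_wpM2r ?invr_ge0 ?(ltW x0)//.
    by rewrite ge0_ler_powR ?nnegrE ?(ltW p0).
  rewrite /U (@eq_integral_support _ _ (E1 `|` (E2 `|` E3))).
  - rewrite ge0_integral_setU//; first last.
    + rewrite disj_set2E; apply/eqP/seteqP; split => // x [].
      by rewrite /E1 /E2 /E3/= !in_itv/= => H1 [H2|H2]; lra.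
    + by apply: mF; apply: measurableU => //; exact: measurableU.
    + exact: measurableU.
    rewrite ge0_integral_setU//; first last.
    + rewrite disj_set2E; apply/eqP/seteqP; split => // x [].
      by rewrite /E2 /E3/= !in_itv/= => H1 H2; lra.
    + by apply: mF; exact: measurableU.
    have -> : g `^ p * ln M + D `^ p * ln 3 =
       D `^ p * (ln 2 - ln 1) + (g `^ p * (ln (2 * M) - ln 2) +
        D `^ p * (ln (3 * M) - ln (2 * M))).
      by rewrite !lnM ?posrE// ln1; ring.
    rewrite !EFinD; apply: leeD; last apply: leeD.
    + apply: integral_le_ln => //; rewrite ?powR_ge0//; first lra.
        exact: mF.
      move=> x; rewrite /E1/= in_itv/= => xE; apply: bound => //; first lra.
      by have := HD M x M1 ltac:(lra); rewrite !ifF//; apply/negbTE; lra.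
    + apply: integral_le_ln => //; rewrite ?powR_ge0//; try lra.
      * by move=> x; rewrite /E2/= !in_itv/= => xE; lra.
      * exact: mF.
      move=> x; rewrite /E2/= in_itv/= => xE; apply: bound; [lra|lra|].
      by have := HD M x M1 ltac:(lra); rewrite ifF ?ifT//; apply/negbTE; lra.
    + apply: integral_le_ln => //; rewrite ?powR_ge0//; try lra.
        exact: mF.
      move=> x; rewrite /E3/= in_itv/= => xE; apply: bound => //; first lra.
      by have := HD M x M1 ltac:(lra); rewrite !ifF//; apply/negbTE; lra.
  - by move=> x [|[]]; rewrite /E1 /E2 /E3/= !in_itv/= => ?; lra.
  - move=> x /=; rewrite in_itv/= andbT => x0 xE; rewrite AE//.
    have xoff : (x < 1) || (3 * M < x).
      apply: contra_notT xE; rewrite negb_or -!leNgt => /andP[x1 x3].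
      have [x2|x2] := leP x 2; first by left; rewrite /E1/= in_itv/= x1.
      have [x2M|x2M] := ltP x (2 * M); first by right; left; rewrite /E2/=
        in_itv/= x2.
      by right; right; rewrite /E3/= in_itv/= x2M.
    have := HD M x M1 x0; rewrite xoff normr_le0 => /eqP ->.
    by rewrite normr0 powR0 ?mul0r//; lra.
have := le_trans (lee_wpmul2l (ltW c0 : (0 <= c%:E)%E) L1) (le_trans LU U1).
by rewrite -EFinM lee_fin.
Qed.

Local Close Scope classical_set_scope.

Theorem proposition4p9 (R : realType) (p alpha : R)
    (hp : 1 < p) (halpha : alpha < 0) :
  2 `^ (alpha - p) * A_cont alpha p <= A_disc alpha p
  /\ A_disc alpha p <= A_cont alpha p.
Proof.
pose g := (p - 1 - alpha) / p.
have p0 : 0 < p by lra.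
have g0 : 0 < g by rewrite divr_gt0//; lra.
have pg : p * g = p - 1 - alpha by rewrite /g; field; lra.
(* As [sup] has a default value on empty or unbounded sets, each comparison also supplies an
   admissible constant or an upper bound. *)
have contE : A_cont alpha p = g `^ p.
  apply/eqP; rewrite eq_le; apply/andP; split.
    apply: ge_sup; first by exists (g `^ p); exact: cont_hardy_lower.
    by move=> c; exact: cont_hardy_upper.
  apply: ub_le_sup; last exact: cont_hardy_lower.
  by exists (g `^ p) => c; exact: cont_hardy_upper.
rewrite contE; split.
  apply: ub_le_sup; last exact: disc_hardy_lower.
  by exists (g `^ p) => c; exact: disc_hardy_upper.
apply: ge_sup; first by exists (2 `^ (alpha - p) * g `^ p); exact:
  disc_hardy_lower.
by move=> c; exact: disc_hardy_upper.
Qed.
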